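(* Let $G$ be a finite group such that $G=A\rtimes H$ (an internal semidirect product, with $A$ normal in $G$), where $A$ and $H$ are subgroups of $G$ and $A$ is abelian. Let $w$ be a group word and suppose that $P(H,w)\geq\frac{1}{|H|}$. Then $P(G,w)\geq\frac{1}{|G|}$.
   Context: A group word $w=w(x_1,\dots,x_n)$ in $n$ variables is an element of the free group $F_n$ on $x_1,\dots,x_n$; for a group $K$ and $\mathbf{g}=(g_1,\dots,g_n)\in K^{(n)}$ (the set of $n$-tuples of elements of $K$), $w(\mathbf{g})\in K$ is the element obtained by substituting $g_i$ for $x_i$. For a finite group $K$, $P(K,w)=\dfrac{|\{\mathbf{g}\in K^{(n)} : w(\mathbf{g})=1\}|}{|K|^n}$ is the probability that a random $n$-tuple of elements of $K$ satisfies $w$. *)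

(* Defs.v *)
From HB Require Import structures.
From mathcomp Require Import all_boot all_order all_algebra all_fingroup.

Set Implicit Arguments.
Unset Strict Implicit.
Unset Printing Implicit Defensive.

Local Open Scope group_scope.

(* The free group F_n, realised by its reduced words.  The letter (i, false)
   stands for x_i and (i, true) for x_i^-1. *)

Section FreeGroup.

Variable n : nat.

Definition letter : Type := ('I_n * bool)%type.

Implicit Types (a b : letter) (s t u v w : seq letter).

Definition letter_inv a : letter := (a.1, ~~ a.2).

Definition reduced s := sorted (fun a b => b != letter_inv a) s.

(* For reduced s, the reduced word equivalent to a :: s. *)
Definition red_cons a s :=
  if s is b :: t then (if b == letter_inv a then t else a :: s) else [:: a].

Definition red_cat s t := foldr red_cons t s.

Definition word_inv s := rev (map letter_inv s).

Lemma letter_invK : involutive letter_inv.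
Proof. by case=> i b; rewrite /letter_inv /= negbK. Qed.

Lemma reduced_behead a s : reduced (a :: s) -> reduced s.
Proof. exact: path_sorted. Qed.

Lemma red_consP a s : reduced s -> reduced (red_cons a s).
Proof.
case: s => [|b s] //= red_s.
by case: ifP => [_|/negbT nba]; [exact: path_sorted red_s | rewrite /= nba].
Qed.

Lemma red_cons_id a s : reduced (a :: s) -> red_cons a s = a :: s.
Proof. by case: s => [|b s] //= /andP[/negbTE-> _]. Qed.

Lemma red_consK a s : reduced s -> red_cons (letter_inv a) (red_cons a s) = s.
Proof.
case: s => [|b s] /= red_s; first by rewrite letter_invK eqxx.
case: eqP => [eqb|_] /=; last by rewrite letter_invK eqxx.
by rewrite -eqb; exact: red_cons_id.
Qed.

Lemma red_consVK a s : reduced s -> red_cons a (red_cons (letter_inv a) s) = s.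
Proof. by move=> red_s; rewrite -{1}[a]letter_invK red_consK. Qed.

Lemma red_catP s t : reduced t -> reduced (red_cat s t).
Proof. by move=> red_t; elim: s => [|a s IHs] //=; exact: red_consP. Qed.

Lemma red_cats0 s : reduced s -> red_cat s [::] = s.
Proof.
elim: s => [|a s IHs] //= red_s.
by rewrite IHs ?(reduced_behead red_s) // red_cons_id.
Qed.

Lemma red_cat_cons a s t :
  reduced t -> red_cat (red_cons a s) t = red_cons a (red_cat s t).
Proof.
case: s => [|b s] //= red_t; case: eqP => [->|_] //=.
by rewrite red_consVK // red_catP.
Qed.

Lemma red_catA s t u :
  reduced u -> red_cat s (red_cat t u) = red_cat (red_cat s t) u.
Proof. by move=> red_u; elim: s => [|a s IHs] //=; rewrite red_cat_cons ?IHs. Qed.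

Lemma word_invK : involutive word_inv.
Proof.
by move=> s; rewrite /word_inv map_rev revK -map_comp map_id_in // => a _ /=;
  rewrite letter_invK.
Qed.

Lemma word_invP s : reduced s -> reduced (word_inv s).
Proof.
rewrite /reduced /word_inv rev_sorted sorted_map; apply: sub_sorted => a b /=.
by apply: contraNneq => ->; rewrite !letter_invK.
Qed.

Lemma red_catVK s t : reduced t -> red_cat (word_inv s) (red_cat s t) = t.
Proof.
move=> red_t; elim: s => [|a s IHs] //=.
by rewrite /word_inv /= rev_cons /red_cat foldr_rcons red_consK ?red_catP.
Qed.

Record free_group := FreeGroup {fg_word :> seq letter; _ : reduced fg_word}.

HB.instance Definition _ := [isSub for fg_word].
HB.instance Definition _ := [Choice of free_group by <:].

Implicit Types x y z : free_group.

Lemma fg_reduced x : reduced x.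
Proof. exact: (valP x). Qed.

Definition fg_one : free_group := @FreeGroup [::] isT.
Definition fg_mul x y : free_group :=
  FreeGroup (red_catP x (fg_reduced y)).
Definition fg_inv x : free_group := FreeGroup (word_invP (fg_reduced x)).

Fact fg_mulA : associative fg_mul.
Proof. by move=> x y z; apply/val_inj/red_catA/fg_reduced. Qed.

Fact fg_mul1 : left_id fg_one fg_mul.
Proof. by move=> x; apply: val_inj. Qed.

Fact fg_mulr1 : right_id fg_one fg_mul.
Proof. by move=> x; apply/val_inj/red_cats0/fg_reduced. Qed.

Fact fg_mulV : left_inverse fg_one fg_inv fg_mul.
Proof.
move=> x; apply: val_inj => /=.
by rewrite -{2}[fg_word x]red_cats0 ?fg_reduced // red_catVK.
Qed.

Fact fg_mulrV : right_inverse fg_one fg_inv fg_mul.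
Proof.
move=> x; rewrite -[RHS](fg_mulV (fg_inv x)); congr fg_mul.
by apply: val_inj; rewrite /= word_invK.
Qed.

HB.instance Definition _ :=
  isGroup.Build free_group fg_mulA fg_mul1 fg_mulr1 fg_mulV fg_mulrV.

Definition fg_gen (i : 'I_n) : free_group := @FreeGroup [:: (i, false)] isT.

End FreeGroup.

Section WordEval.

Variables (n : nat) (K : groupType) (g : 'I_n -> K).

Definition letter_eval (a : letter n) : K :=
  if a.2 then (g a.1)^-1 else g a.1.

(* w(g_1, ..., g_n): substitute g i for x_i in w. *)
Definition word_eval (w : free_group n) : K :=
  \prod_(a <- fg_word w) letter_eval a.

Lemma word_eval_gen i : word_eval (fg_gen i) = g i.
Proof. by rewrite /word_eval big_seq1. Qed.

Fact word_eval_is_morphism : monoid.monoid_morphism word_eval.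
Proof.
split=> [|x y]; first by rewrite /word_eval big_nil.
rewrite /word_eval /= /red_cat; elim: (fg_word x) => [|a s IHs] /=.
  by rewrite big_nil mul1g.
rewrite big_cons -mulgA -IHs; case: (foldr _ _ s) => [|b t] /=.
  by rewrite big_seq1 big_nil mulg1.
case: eqP => [->|_]; last by rewrite big_cons.
rewrite big_cons mulgA /letter_eval; case: (a) => i [] /=.
  by rewrite mulVg mul1g.
by rewrite mulgV mul1g.
Qed.

HB.instance Definition _ :=
  isUMagmaMorphism.Build (free_group n) K word_eval word_eval_is_morphism.

End WordEval.

(* P(K, w), with K a subgroup of an ambient finite group. *)
Definition word_prob (gT : finGroupType) (K : {group gT}) (n : nat)
    (w : free_group n) : rat :=
  (#|[set g : {ffun 'I_n -> gT} in ffun_on [in K] | word_eval g w == 1%g]|%:R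
     / #|K|%:R ^+ n)%R.

(* Main.v *)
Require Import Defs.
From mathcomp Require Import all_boot all_order all_algebra all_fingroup.

(** For a solution h of w in H, the map a |-> w(a_1 h_1, ..., a_n h_n) is a
    homomorphism from A^n to the abelian group A: peeling letters off w writes
    it as a product of H-conjugates of the a_i and their inverses, which is the
    Fox derivative of w at h evaluated at a (foxM, fox_in).  Its kernel has at
    least |A|^n / |A| elements (leq_card_fox_ker), and each of them gives a
    solution (a_i h_i) of w in G.  Since A meets H trivially, distinct pairs
    (h, a) give distinct solutions, so that writing N(K) for the number of
    solutions of w in K^n,
      N(G) |A| >= N(H) |A|^n    (leq_card_solutions).
    Dividing by |G|^n |A| = |A|^n |H|^n |A| turns this into
    P(G, w) >= P(H, w) / |A|, and |G| = |A| |H| gives the bound. *)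

Set Implicit Arguments.
Unset Strict Implicit.
Unset Printing Implicit Defensive.

Import GRing.Theory Num.Theory.

Local Open Scope group_scope.

Section FoxCocycle.

Variables (gT : finGroupType) (n : nat).
Implicit Types (A H : {group gT}) (a b h : 'I_n -> gT) (x : letter n).

Definition translate a h : 'I_n -> gT := fun i => a i * h i.

(** The Fox derivative of the word at h, evaluated at a, in multiplicative
    notation.  It takes an arbitrary letter sequence, because the induction
    behind its properties removes letters one at a time. *)
Definition fox h a (s : seq (letter n)) : gT :=
  \prod_(x <- s) letter_eval (translate a h) x
    * (\prod_(x <- s) letter_eval h x)^-1.

Lemma fox_nil h a : fox h a [::] = 1.
Proof. by rewrite /fox !big_nil mul1g invg1. Qed.

(** The product rule of Fox calculus: D(xs) = D(x) . (x D(s)), where x acts by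
    conjugation. *)
Lemma fox_cons h a x s :
  fox h a (x :: s) = fox h a [:: x] * fox h a s ^ (letter_eval h x)^-1.
Proof.
by rewrite /fox !big_cons !big_nil !mulg1 conjgE invMg invgK !mulgA mulgKV.
Qed.

Lemma fox1 h a x :
  fox h a [:: x] = if x.2 then (a x.1)^-1 ^ h x.1 else a x.1.
Proof.
rewrite /fox !big_seq1 /letter_eval /translate; case: x => i [] /=.
  by rewrite invMg invgK conjgE mulgA.
by rewrite mulgK.
Qed.

Lemma letter_eval_norm A h x :
  (forall i, h i \in 'N(A)) -> letter_eval h x \in 'N(A).
Proof. by move=> nAh; rewrite /letter_eval; case: x.2; rewrite ?groupV. Qed.

Lemma fox1_in A h a x :
  (forall i, h i \in 'N(A)) -> (forall i, a i \in A) -> fox h a [:: x] \in A.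
Proof.
by move=> nAh Aa; rewrite fox1; case: x.2; rewrite // memJ_norm ?groupV.
Qed.

Lemma fox_in A h a s :
  (forall i, h i \in 'N(A)) -> (forall i, a i \in A) -> fox h a s \in A.
Proof.
move=> nAh Aa; elim: s => [|x s IHs]; first by rewrite fox_nil.
by rewrite fox_cons groupM ?fox1_in ?memJ_norm ?groupV ?letter_eval_norm.
Qed.

(** Commutativity of A enters twice: it lets inversion be multiplicative on the
    letters x_i^-1, and lets the factors of the product rule be regrouped. *)
Lemma foxM A h a b s :
    abelian A -> (forall i, h i \in 'N(A)) ->
    (forall i, a i \in A) -> (forall i, b i \in A) ->
  fox h (fun i => a i * b i) s = fox h a s * fox h b s.
Proof.
move=> /centsP cAA nAh Aa Ab; elim: s => [|x s IHs].
  by rewrite !fox_nil mulg1.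
rewrite fox_cons [fox h a _]fox_cons [fox h b _]fox_cons IHs conjMg.
have -> : fox h (fun i => a i * b i) [:: x] = fox h a [:: x] * fox h b [:: x].
  rewrite !fox1; case: x.2 => //.
  by rewrite -conjMg -invMg (cAA (b x.1)).
have swap : fox h b [:: x] * fox h a s ^ (letter_eval h x)^-1
            = fox h a s ^ (letter_eval h x)^-1 * fox h b [:: x].
  by apply: cAA; rewrite ?fox1_in // memJ_norm ?fox_in // groupV letter_eval_norm.
(* Generalised, since mulgA would otherwise also match the product that fox
   unfolds to. *)
move: (fox h a [:: x]) (fox h b [:: x]) (fox h a s ^ _) (fox h b s ^ _) swap.
by move=> p q r t qr; rewrite !mulgA -(mulgA p) qr mulgA.
Qed.

End FoxCocycle.

Section Counting.

Variables (gT : finGroupType) (n : nat).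
Implicit Types (K A H G : {group gT}) (w : free_group n).

(** Spelled as a family of groups, so that A^n carries the group structure of
    an external direct product. *)
Local Notation tuples := {dffun forall _ : 'I_n, gT}.
Local Notation power A := (setXn (fun _ : 'I_n => A)).

Definition solutions K w : {set {ffun 'I_n -> gT}} :=
  [set g : {ffun 'I_n -> gT} in ffun_on [in K] | word_eval g w == 1].

Lemma solutionsP K w (g : {ffun 'I_n -> gT}) :
  reflect ((forall i, g i \in K) /\ word_eval g w = 1) (g \in solutions K w).
Proof.
rewrite inE; apply: (iffP andP) => [[/ffun_onP Kg /eqP]|[Kg ->]] //.
by split=> //; apply/ffun_onP.
Qed.

Lemma card_power A : #|power A| = (#|A| ^ n)%N.
Proof. by rewrite cardsXn prod_nat_const card_ord. Qed.

Definition fox_ker A (h : 'I_n -> gT) w : {set tuples} :=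
  [set a in power A | fox h a w == 1].

(** First isomorphism theorem for a |-> fox h a w, whose image lies in A. *)
Lemma leq_card_fox_ker A (h : 'I_n -> gT) w :
    abelian A -> (forall i, h i \in 'N(A)) ->
  (#|A| ^ n <= #|fox_ker A h w| * #|A|)%N.
Proof.
move=> abelA nAh.
have morphF : {in power A &, {morph (fun a : tuples => fox h a w) : a b / a * b}}.
  move=> a b /setXnP Aa /setXnP Ab; rewrite /= -(foxM _ abelA nAh Aa Ab).
  rewrite /fox; congr (_ * _); apply: eq_bigr => x _.
  by rewrite /letter_eval /translate !ffunE.
pose f := Morphism morphF.
have -> : fox_ker A h w = 'ker f.
  by apply/setP=> a; rewrite !inE.
rewrite -card_power -(Lagrange (subsetIl _ _ : 'ker f \subset _)) leq_mul2l.
apply/orP; right; rewrite -[X in #|X : _|]setIid -card_morphim subset_leq_card //.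
by apply/subsetP=> _ /morphimP[a _ /setXnP Aa ->]; apply: fox_in.
Qed.

(** Solutions in G lie over solutions in H, and the translates of h by
    fox_ker A h w lie over h; uniqueness of the decomposition G = A H makes the
    fibres disjoint and the translates distinct. *)
Lemma leq_card_solutions G A H w :
    A ><| H = G -> abelian A ->
  (#|solutions H w| * #|A| ^ n <= #|solutions G w| * #|A|)%N.
Proof.
move=> defG abelA; have [_ mulAH nAH tiAH] := sdprodP defG.
pose X := [set p : {ffun 'I_n -> gT} * {ffun 'I_n -> gT} |
             (p.1 \in solutions H w) && (p.2 \in fox_ker A p.1 w)].
pose tr (p : {ffun 'I_n -> gT} * {ffun 'I_n -> gT}) :=
  [ffun i => translate p.2 p.1 i].
have cardX : #|X| = (\sum_(h in solutions H w) #|fox_ker A h w|)%N.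
  rewrite -sum1_card (eq_bigl _ _ (fun p => in_set _ p)).
  rewrite -(pair_big_dep _ (fun h a => a \in fox_ker A (h : {ffun _}) w)
     (fun _ _ => 1%N)) /=.
  by apply: eq_bigr => h _; rewrite sum1_card.
have leX : (#|X| <= #|solutions G w|)%N.
  have injtr : {in X &, injective tr}.
    move=> [h a] [h' a']; rewrite !inE /=.
    move=> /andP[/andP[/ffun_onP Hh _] /andP[/forallP Aa _]].
    move=> /andP[/andP[/ffun_onP Hh' _] /andP[/forallP Aa' _]] /ffunP eqt.
    have eqi i : a i = a' i /\ h i = h' i.
      have := eqt i; rewrite !ffunE /translate /= => e.
      split.
        by rewrite -(divgrMid tiAH (Aa i) (Hh i)) e divgrMid.
      by rewrite -(remgrMid tiAH (Aa i) (Hh i)) e remgrMid.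
    by congr (_, _); apply/ffunP=> i; case: (eqi i).
  rewrite -(card_in_imset injtr); apply: subset_leq_card.
  apply/subsetP=> _ /imsetP[[h a] + ->]; rewrite inE /=.
  case/andP=> /solutionsP[Hh wh]; rewrite inE => /andP[/setXnP Aa /eqP].
  rewrite /fox -!/(word_eval _ _) wh invg1 mulg1 => wah.
  apply/solutionsP; split=> [i|].
    by rewrite ffunE -mulAH mem_mulg.
  rewrite -[RHS]wah; apply: eq_bigr => x _.
  by rewrite /letter_eval !ffunE.
apply: leq_trans (leq_mul leX (leqnn #|A|)).
rewrite cardX big_distrl -sum_nat_const /=; apply: leq_sum => h.
case/solutionsP=> Hh _; apply: leq_card_fox_ker => // i.
exact: (subsetP nAH).
Qed.

End Counting.

Theorem proposition1p3 (gT : finGroupType) (G A H : {group gT})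
    (defG : A ><| H = G) (abelA : abelian A)
    (n : nat) (w : free_group n)
    (hH : (1 / #|H|%:R <= word_prob H w)%R) :
  (1 / #|G|%:R <= word_prob G w)%R.
Proof.
have gt0 (K : {group gT}) : (0 < #|K|%:R :> rat)%R by rewrite ltr0n cardG_gt0.
have gt0X (K : {group gT}) : (0 < #|K|%:R ^+ n :> rat)%R by rewrite exprn_gt0.
move: hH; rewrite /word_prob -!/(solutions _ w).
rewrite !ler_pdivrMr // ![(_ / _ * _)%R]mulrAC !ler_pdivlMr // !mul1r => hH.
have hA := leq_card_solutions w defG abelA.
have -> : #|G| = (#|A| * #|H|)%N by rewrite (sdprod_card defG).
move: hH; rewrite -!natrX -!natrM !ler_nat => hH.
rewrite expnMn mulnA.
apply: leq_trans (leq_mul hA (leqnn #|H|)).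
by rewrite mulnAC mulnC leq_mul2r hH orbT.
Qed.
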